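(* Given any $\epsilon > 0$, any algorithm achieving a $(2-\epsilon)$-approximation for the Symmetric Submodular $k$-Multiway Partitioning problem (Sym-Sub-$k$-MP) when $k$ is part of the input, requires exponentially many queries in the value oracle model.
   Context: For a finite set $V$, a function $f:2^V\to\mathbb{R}$ is submodular if $f(A\cup\{v\})-f(A)\ge f(B\cup\{v\})-f(B)$ for all $A\subseteq B\subseteq V$ and $v\notin B$; it is symmetric if $f(S)=f(V\setminus S)$ for all $S\subseteq V$. The symbol $\uplus$ denotes the union of disjoint sets and $[k]=\{1,\dots,k\}$. Sym-Sub-$k$-MP: given a non-negative symmetric submodular function $f:2^V\to\mathbb{R}_+$ over a ground set $V$, partition $V$ into $k$ non-empty sets so as to attain $$\min \sum_{i=1}^k f(S_i)\quad\text{s.t. } S_1\uplus S_2\uplus\cdots\uplus S_k=V,\ S_i\neq\emptyset \text{ for all } i\in[k].$$ Value oracle model: $f$ is accessed through an oracle that returns $f(S)$ for a given set $S\subseteq V$. Hardness results in this model are information-theoretic: they are limits on the approximability of a problem when only polynomially many queries to the value oracle are allowed. An algorithm achieves an $\alpha$-approximation if it outputs a feasible $(S_1,\dots,S_k)$ with $\sum_i f(S_i)$ at most $\alpha$ times the optimal value. *)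

(* Defs.v *)
(* MathComp / MathComp-Analysis *)
From HB Require Import structures.
From mathcomp Require Import all_boot all_order all_algebra.
From mathcomp Require Import all_classical all_reals all_analysis.

Set Implicit Arguments.
Unset Strict Implicit.
Unset Printing Implicit Defensive.

Import Order.TTheory GRing.Theory Num.Theory.

Local Open Scope ring_scope.

Definition nonnegative (R : realType) (V : finType) (f : {set V} -> R) : Prop :=
  forall S : {set V}, 0 <= f S.

Definition symmetric_setfun (R : realType) (V : finType) (f : {set V} -> R) : Prop :=
  forall S : {set V}, f S = f (~: S)%SET.

Definition submodular (R : realType) (V : finType) (f : {set V} -> R) : Prop :=
  forall (A B : {set V}) (v : V), A \subset B -> v \notin B ->
    f (v |: B)%SET - f B <= f (v |: A)%SET - f A.

Definition sym_sub_instance (R : realType) (V : finType) (f : {set V} -> R) : Prop :=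
  [/\ nonnegative f, symmetric_setfun f & submodular f].

Definition kpartition (V : finType) (k : nat) (S : {ffun 'I_k -> {set V}}) : Prop :=
  [/\ forall i : 'I_k, S i != finset.set0,
      forall i j : 'I_k, i != j -> [disjoint S i & S j]
    & (\bigcup_(i < k) S i)%SET = [set: V]%SET].

Definition cost (R : realType) (V : finType) (k : nat) (f : {set V} -> R)
    (S : {ffun 'I_k -> {set V}}) : R :=
  \sum_(i < k) f (S i).

(* A minimum over a finite set, nonempty exactly when V has a k-partition. *)
Definition opt (R : realType) (V : finType) (k : nat) (f : {set V} -> R) : R :=
  inf [set cost f S | S in [set S : {ffun 'I_k -> {set V}} | kpartition S]]%classic.

Definition approx_solution (R : realType) (alpha : R) (V : finType) (k : nat)
    (f : {set V} -> R) (S : {ffun 'I_k -> {set V}}) : Prop :=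
  kpartition S /\ cost f S <= alpha * opt k f.

(* A deterministic adaptive procedure of unlimited computational power that
   sees the set function only through value queries: [Query Q next] asks for
   f(Q) and goes on with [next (f Q)]. *)
Inductive query_tree (R : Type) (V : finType) (O : Type) : Type :=
| Answer of O
| Query of {set V} & (R -> query_tree R V O).

Fixpoint output (R : Type) (V : finType) (O : Type) (f : {set V} -> R)
    (t : query_tree R V O) : O :=
  match t with
  | Answer o => o
  | Query Q next => output f (next (f Q))
  end.

Fixpoint nqueries (R : Type) (V : finType) (O : Type) (f : {set V} -> R)
    (t : query_tree R V O) : nat :=
  match t with
  | Answer _ => 0%N
  | Query Q next => (nqueries f (next (f Q))).+1
  end.

(* The input is the ground set and k, together with oracle access to f. *)
Definition partition_algorithm (R : realType) : Type :=
  forall (V : finType) (k : nat), query_tree R V {ffun 'I_k -> {set V}}.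

(* A randomized algorithm is a family of deterministic ones indexed by the
   sample points of a probability space, such that on every instance the output
   and the number of queries are (discrete) random variables.  Deterministic
   algorithms are the constant families. *)
Definition measurable_algorithm (R : realType) (d : measure_display)
    (Omega : measurableType d) (A : Omega -> partition_algorithm R) : Prop :=
  forall (V : finType) (k : nat) (f : {set V} -> R),
    (0 < k <= #|V|)%N -> sym_sub_instance f ->
    (forall S, measurable [set w | output f (A w V k) = S]%classic) /\
    (forall q, measurable [set w | nqueries f (A w V k) = q]%classic).

(* For a deterministic algorithm and p in ]0, 1] this says that the output is
   an alpha-approximate solution on every instance. *)
Definition achieves_approximation (R : realType) (d : measure_display)
    (Omega : measurableType d) (P : probability Omega R) (alpha p : R)
    (A : Omega -> partition_algorithm R) : Prop :=
  forall (V : finType) (k : nat) (f : {set V} -> R),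
    (0 < k <= #|V|)%N -> sym_sub_instance f ->
    (p%:E <= P [set w | approx_solution alpha f (output f (A w V k))]%classic)%E.

Definition expected_queries (R : realType) (d : measure_display)
    (Omega : measurableType d) (P : probability Omega R)
    (A : Omega -> partition_algorithm R) (V : finType) (k : nat)
    (f : {set V} -> R) : \bar R :=
  (\int[P]_w ((nqueries f (A w V k))%:R)%:E)%E.

(* Main.v *)
Require Import Defs.
From mathcomp Require Import all_boot all_order all_algebra.
From mathcomp Require Import all_classical all_reals all_analysis.
From mathcomp Require Import measurable_realfun fintype finset ring lra.

(** The clique cut function f(S) = |S| |V \ S| has no k-partition of cost below
    M (2 n - M - 1), where k = M + 1 and n = |V|.  For a set H of size M let
    tau_H(S) = |S /\ H| / |H| - |S \ H| / |V \ H|.  Subtracting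
    |H| |V \ H| tau_H(S)^2 from f(S) would make V \ H free, so that V \ H and
    the singletons of H form a k-partition of cost about M n, cheaper by a
    factor close to 2 when M / n is small.  Replacing tau_H^2 by the squared
    distance of tau_H to [-delta, delta] costs only O(delta M n), and makes the
    planted function equal to f on every S that H splits evenly.  It stays
    submodular because both t |-> dist(t, [-delta, delta])^2 and its difference
    with t^2 are convex.

    Let H pick one uniform element from each of M disjoint blocks of constant
    size.  By Hoeffding's bound a fixed S is split unevenly with probability
    exponentially small in n.  A run succeeding on the planted function must
    have queried on f, or output, a set on which the two functions differ;
    averaging over H shows that the expected number of queries on f is
    exponential. *)

Set Implicit Arguments.
Unset Strict Implicit.
Unset Printing Implicit Defensive.

Import Order.TTheory GRing.Theory Num.Theory.

Local Open Scope ring_scope.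

(** * Squared distance to an interval and its convexity *)

Section SquaredDistance.
Variables (R : realType) (delta : R).

Definition clip (t : R) : R := Num.max (- delta) (Num.min t delta).

Definition sqdist (t : R) : R := (t - clip t) ^+ 2.

Lemma clipP (t : R) : 0 <= delta ->
  [\/ t <= - delta /\ clip t = - delta,
      - delta <= t <= delta /\ clip t = t
    | delta <= t /\ clip t = delta].
Proof.
move=> d0; rewrite /clip; case: (lerP t delta) => td.
  case: (lerP (- delta) t) => dt; first by constructor 2; split=> //; rewrite dt.
  by constructor 1; split=> //; apply: ltW.
constructor 3; split; first exact: ltW.
by apply/max_idPr; lra.
Qed.

Lemma sqdist_ge0 t : 0 <= sqdist t. Proof. exact: sqr_ge0. Qed.

Lemma sqdist_le_sqr t : 0 <= delta -> sqdist t <= t ^+ 2.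
Proof. by move=> d0; rewrite /sqdist; case: (clipP t d0) => -[h ->]; nra. Qed.

Lemma sqdistN t : 0 <= delta -> sqdist (- t) = sqdist t.
Proof.
move=> d0; rewrite /sqdist.
by case: (clipP t d0) => -[h ->]; case: (clipP (- t) d0) => -[h' ->]; nra.
Qed.

Lemma sqdist_eq0 t : `|t| <= delta -> sqdist t = 0.
Proof.
move=> td; have d0 : 0 <= delta := le_trans (normr_ge0 t) td.
move: td; rewrite ler_norml /sqdist => /andP[h1 h2].
by case: (clipP t d0) => -[h ->]; apply/eqP; rewrite sqrf_eq0; apply/eqP; lra.
Qed.

Lemma sqdist1 : 0 <= delta -> delta <= 1 -> sqdist 1 = (1 - delta) ^+ 2.
Proof.
move=> d0 d1; rewrite /sqdist.
by case: (clipP 1 d0) => -[h ->]; congr (_ ^+ 2); lra.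
Qed.

(** The points [t + w] and [t + z] lie between [t] and [t + w + z] and have the same sum, so this is
    convexity, expressed through subgradients [s]. *)
Lemma subgradient_four_point (phi s : R -> R) (t w z : R) :
    (forall x y, phi x + s x * (y - x) <= phi y) -> 0 <= w * z ->
  phi (t + w) + phi (t + z) <= phi t + phi (t + w + z).
Proof.
move=> sub wz.
have [->|zw] := eqVneq z w.
  by have := sub (t + w) t; have := sub (t + w) (t + w + w); lra.
have := sub (t + w) t; have := sub (t + z) t.
have := sub (t + w) (t + w + z); have := sub (t + z) (t + w + z).
have := sub (t + w) (t + z); have := sub (t + z) (t + w).
have -> : t - (t + w) = - w by ring.
have -> : t - (t + z) = - z by ring.
have -> : t + w + z - (t + w) = z by ring.
have -> : t + w + z - (t + z) = w by ring.
have -> : t + z - (t + w) = z - w by ring.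
have -> : t + w - (t + z) = w - z by ring.
move: (s (t + w)) (s (t + z)) => a b *.
have mono : 0 <= (b - a) * (z - w) by lra.
have zw2 : 0 < (z - w) ^+ 2 by rewrite exprn_even_gt0 //= subr_eq0.
(* The inequalities from [t + w] to [t] and from [t + z] to [t + w + z] add up to the claim with
   surplus [(b - a) * w]; exchanging [w] and [z] gives surplus [(a - b) * z]. *)
suff : 0 <= (b - a) * w \/ 0 <= (a - b) * z by case; lra.
have [w0|w0] := lerP 0 w; have [z0|z0] := lerP 0 z.
- have [zw'|zw'] := lerP w z; first by left; apply: mulr_ge0 => //; nra.
  by right; apply: mulr_ge0 => //; nra.
- by left; have ->: w = 0; [nra | rewrite mulr0].
- by right; have ->: z = 0; [nra | rewrite mulr0].
- have [zw'|zw'] := lerP w z; first by right; apply: mulr_le0; nra.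
  by left; apply: mulr_le0; nra.
Qed.

Lemma clip_bound t : 0 <= delta -> - delta <= clip t <= delta.
Proof. by move=> d0; case: (clipP t d0) => -[h ->]; lra. Qed.

(** The variational inequality of the projection onto [-delta, delta]; both subgradient bounds below
    follow from it by completing a square. *)
Lemma clip_projection x y : 0 <= delta ->
  (x - clip x) * (clip y - clip x) <= 0.
Proof.
move=> d0; have := clip_bound y d0; move: (clip y) => c.
by case: (clipP x d0) => -[h ->]; nra.
Qed.

Lemma sqdist_subgradient x y : 0 <= delta ->
  sqdist x + 2 * (x - clip x) * (y - x) <= sqdist y.
Proof.
move=> d0; have := clip_projection x y d0.
have := sqr_ge0 ((y - clip y) - (x - clip x)).
by rewrite /sqdist; lra.
Qed.

Lemma sqr_sub_sqdist_subgradient x y : 0 <= delta ->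
  (x ^+ 2 - sqdist x) + 2 * clip x * (y - x) <= y ^+ 2 - sqdist y.
Proof.
move=> d0; have := clip_projection y x d0.
have := sqr_ge0 (clip y - clip x).
by rewrite /sqdist; lra.
Qed.

(** For [0 <= w * z] this is convexity of [sqdist]. Otherwise convexity of t^2 - sqdist t, from base
    [t + w] with steps [- w] and [z], bounds the left side by its value for t^2. *)
Lemma sqdist_four_point t w z : 0 <= delta ->
  sqdist (t + w) + sqdist (t + z) - sqdist t - sqdist (t + w + z)
    <= Num.max 0 (- 2 * (w * z)).
Proof.
move=> d0; have [wz|wz] := lerP 0 (w * z).
  have := subgradient_four_point t (fun x y => sqdist_subgradient x y d0) wz.
  by rewrite le_max; lra.
have wz' : 0 <= - w * z by lra.
have := subgradient_four_point (t + w) (fun x y => sqr_sub_sqdist_subgradient x y d0) wz'.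
rewrite addrK; rewrite le_max => h; apply/orP; right.
by move: h; nra.
Qed.

End SquaredDistance.

(** * Clique cut, imbalance and the planted function *)

Section SetFunctions.
Variables (R : realType) (V : finType).
Implicit Types (A B S H : {set V}) (v : V).

Definition clique_cut S : R := #|S|%:R * #|~: S|%SET%:R.

Lemma clique_cut_instance : sym_sub_instance clique_cut.
Proof.
split=> [S|S|A B v sAB vB].
- by rewrite mulr_ge0.
- by rewrite /clique_cut setCK mulrC.
have vA : v \notin A by apply: contra vB; apply: (subsetP sAB).
have cC S : #|~: S|%SET%:R = #|V|%:R - #|S|%:R :> R.
  by rewrite -(cardsC S) natrD; ring.
have : (#|A| <= #|B|)%N by exact: subset_leq_card.
rewrite -(ler_nat R) /clique_cut !cC !cardsU1 vA vB !natrD /=.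
by lra.
Qed.

(** Additive over disjoint sets, with value 1 on [H] and -1 on its complement when both are
    nonempty. *)
Definition imbalance H S : R :=
  #|S :&: H|%SET%:R / #|H|%:R - #|S :\: H|%SET%:R / #|~: H|%SET%:R.

Lemma imbalanceU H A B : [disjoint A & B] ->
  imbalance H (A :|: B)%SET = imbalance H A + imbalance H B.
Proof.
move=> dAB; rewrite /imbalance setIUl setDUl !cardsU.
have dI (C D : {set V}) : C \subset A -> D \subset B -> #|C :&: D|%SET = 0%N.
  move=> sCA sDB; apply/eqP; rewrite cards_eq0 setI_eq0.
  exact: disjointWl sCA (disjointWr sDB dAB).
rewrite (dI (A :&: H) (B :&: H)) ?subsetIl// (dI (A :\: H) (B :\: H)) ?subsetDl//.
by rewrite !subn0 !natrD; ring.
Qed.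

Lemma imbalance_setT H : H != set0 -> (~: H)%SET != set0 ->
  imbalance H [set: V]%SET = 0.
Proof.
rewrite -!card_gt0 -!(ltr_nat R) => H0 HC0.
by rewrite /imbalance setTI setTD !divff ?gt_eqF// subrr.
Qed.

Lemma imbalanceC H S : H != set0 -> (~: H)%SET != set0 ->
  imbalance H (~: S)%SET = - imbalance H S.
Proof.
move=> H0 HC0; apply: (addrI (imbalance H S)); rewrite subrr -imbalanceU.
  by rewrite setUCr imbalance_setT.
by rewrite disjoints_subset setCK.
Qed.

(* Only elements of [B :\: A] on the opposite side of [H] from [v] contribute
   positively, each by at most [1] after scaling. *)
Lemma imbalance_marginal v H A B : A \subset B ->
  - (#|H|%:R * #|~: H|%SET%:R * (imbalance H [set v]%SET * imbalance H (B :\: A)%SET))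
    <= #|B|%:R - #|A|%:R.
Proof.
move=> sAB; rewrite -natrB ?subset_leq_card// -cardsDS//.
set D := (B :\: A)%SET.
have [H0|H0] := posnP #|H|; first by rewrite H0 !mul0r oppr0.
have [C0|C0] := posnP #|~: H|%SET; first by rewrite C0 mulr0 mul0r oppr0.
rewrite -(cardsID H D) natrD /imbalance.
move: H0 C0; rewrite -!(ltr_nat R).
move: (#|H|%:R) (#|~: H|%SET%:R) => h c h0 c0.
have p0 : 0 <= #|D :&: H|%SET%:R :> R by [].
have q0 : 0 <= #|D :\: H|%SET%:R :> R by [].
move: (#|D :&: H|%SET%:R) (#|D :\: H|%SET%:R) p0 q0 => p q p0 q0.
have ch : 0 <= c / h by rewrite divr_ge0 // ltW.
have hc : 0 <= h / c by rewrite divr_ge0 // ltW.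
have [vH|vH] := boolP (v \in H).
  have -> : ([set v] :&: H = [set v])%SET by apply/setIidPl; rewrite sub1set.
  have -> : ([set v] :\: H = set0)%SET.
    by apply/eqP; rewrite setD_eq0 sub1set.
  rewrite cards1 cards0.
  have -> : - (h * c * ((1 / h - 0 / c) * (p / h - q / c))) = q - p * (c / h).
    by field; rewrite !gt_eqF.
  by have := mulr_ge0 p0 ch; lra.
have -> : ([set v] :&: H = set0)%SET.
  by apply/eqP; rewrite setI_eq0 disjoints1.
have -> : ([set v] :\: H = [set v])%SET.
  by apply/setDidPl; rewrite disjoints1.
rewrite cards1 cards0.
have -> : - (h * c * ((0 / h - 1 / c) * (p / h - q / c))) = p - q * (h / c).
  by field; rewrite !gt_eqF.
by have := mulr_ge0 q0 hc; lra.
Qed.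

(** Yields nonnegativity of the planted function. The difference is |V| times two nonnegative terms,
    one from the split of [H] by [S], one from the split of its complement. *)
Lemma imbalance_sqr_le H S :
  #|H|%:R * #|~: H|%SET%:R * imbalance H S ^+ 2 <= clique_cut S.
Proof.
have [H0|H0] := posnP #|H|; first by rewrite H0 !mul0r mulr_ge0.
have [C0|C0] := posnP #|~: H|%SET; first by rewrite C0 mulr0 mul0r mulr_ge0.
have a1 : (#|S :&: H| <= #|H|)%N by rewrite subset_leq_card// subsetIr.
have b1 : (#|S :\: H| <= #|~: H|)%N by rewrite subset_leq_card// setDE subsetIr.
move: H0 C0 a1 b1; rewrite /clique_cut /imbalance.
have -> : #|~: S|%SET%:R = #|H|%:R + #|~: H|%SET%:R - #|S|%:R :> R.
  by rewrite -natrD cardsC -(cardsC S) natrD; ring.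
rewrite -(cardsID H S) natrD -!(ltr_nat R) -!(ler_nat R).
have a0 : 0 <= #|S :&: H|%SET%:R :> R by [].
have b0 : 0 <= #|S :\: H|%SET%:R :> R by [].
move: (#|H|%:R) (#|~: H|%SET%:R) (#|S :&: H|%SET%:R) (#|S :\: H|%SET%:R) a0 b0.
move=> h c a b a0 b0 h0 c0 ah bc; rewrite -subr_ge0.
have -> : (a + b) * (h + c - (a + b)) - h * c * (a / h - b / c) ^+ 2
  = (h + c) * (a * (h - a) / h + b * (c - b) / c).
  by field; rewrite !gt_eqF.
by rewrite mulr_ge0 ?addr_ge0 ?divr_ge0 ?mulr_ge0 ?subr_ge0// ltW.
Qed.

(** The coefficient is the clique cut of [H], so for [delta] = 0 the function vanishes on [H] and on
    its complement. *)
Definition planted_cut (delta : R) H S : R :=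
  clique_cut S - #|H|%:R * #|~: H|%SET%:R * sqdist delta (imbalance H S).

Lemma planted_cut_le (delta : R) H S : planted_cut delta H S <= clique_cut S.
Proof. by rewrite /planted_cut lerBlDr lerDl mulr_ge0 ?sqdist_ge0// mulr_ge0. Qed.

(** From [A] to [B] the marginal of [v] in the clique cut drops by 2 (|B| - |A|). By
    [sqdist_four_point] and [imbalance_marginal] the subtracted term takes back at most this
    much. *)
Lemma planted_cut_instance (delta : R) H : 0 <= delta ->
  H != set0 -> (~: H)%SET != set0 ->
  sym_sub_instance (planted_cut delta H).
Proof.
move=> d0 H0 HC0; have [_ cS cM] := clique_cut_instance; split=> [S|S|A B v sAB vB].
- rewrite /planted_cut subr_ge0; apply: le_trans (imbalance_sqr_le H S).
  by rewrite ler_wpM2l ?mulr_ge0 ?sqdist_le_sqr.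
- by rewrite /planted_cut -cS imbalanceC// sqdistN.
have vA : v \notin A by apply: contra vB; apply: (subsetP sAB).
have vD S : v \notin S -> imbalance H (v |: S)%SET = imbalance H S + imbalance H [set v]%SET.
  by move=> vS; rewrite imbalanceU ?disjoints1// addrC.
have BE : imbalance H B = imbalance H A + imbalance H (B :\: A)%SET.
  rewrite -imbalanceU ?disjoints_subset ?setCD ?subsetUr//.
  by congr (imbalance H); rewrite -{1}(setID B A) (setIidPr sAB).
have cC S : #|~: S|%SET%:R = #|V|%:R - #|S|%:R :> R.
  by rewrite -(cardsC S) natrD; ring.
have := imbalance_marginal v H sAB.
have : 0 <= #|H|%:R * #|~: H|%SET%:R :> R by rewrite mulr_ge0.
rewrite /planted_cut; move: (#|H|%:R * #|~: H|%SET%:R) => m m0 mz.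
have := sqdist_four_point (imbalance H A) (imbalance H [set v]%SET)
  (imbalance H (B :\: A)%SET) d0.
have : (#|A| <= #|B|)%N by exact: subset_leq_card.
rewrite -(ler_nat R) !vD// BE /clique_cut !cC !cardsU1 vA vB !natrD /=.
rewrite [_ + imbalance H (B :\: A)%SET + _]addrAC => AB.
rewrite le_max => /orP[] /(ler_wpM2l m0); lra.
Qed.

End SetFunctions.

(** * Costs of k-partitions *)

Section Costs.
Variables (R : realType) (V : finType).
Implicit Types (H : {set V}).

Lemma kpartition_card_sum k (S : {ffun 'I_k -> {set V}}) :
  kpartition S -> (\sum_i #|S i|)%N = #|V|.
Proof.
case=> _ dS US; rewrite -cardsT -US -sum1_card partition_disjoint_bigcup//.
by apply: eq_bigr => i _; rewrite sum1_card.
Qed.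

(** A part of size s costs s (n - s), which is concave on 1 <= s <= n - M and hence above its chord
    there; the chords are affine, so they sum to the bound. *)
Lemma clique_cut_cost_ge M (S : {ffun 'I_M.+1 -> {set V}}) : kpartition S ->
  M%:R * (2 * #|V|%:R - M%:R - 1) <= cost (@clique_cut R V) S.
Proof.
move=> pS; have sS := kpartition_card_sum pS; case: pS => nS _ _.
have S1 i : (0 < #|S i|)%N by rewrite card_gt0.
have Sle i : (#|S i| + M <= #|V|)%N.
  rewrite -sS (bigD1 i)//= leq_add2l.
  have e : (\sum_(j < M.+1 | j != i) 1)%N = M by rewrite sum1_card cardC1 card_ord.
  by rewrite -[leqLHS]e leq_sum.
have {sS} : \sum_i (#|S i|%:R : R) = #|V|%:R by rewrite -natr_sum sS.
move=> sS.
(* [(s - 1) * (r - s) >= 0] for a part of size [1 <= s <= r] *)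
pose r : R := #|V|%:R - M%:R.
apply: (@le_trans _ _ (\sum_(i < M.+1) ((M%:R - 1) * #|S i|%:R + r))).
  rewrite big_split /= -mulr_sumr sS sumr_const card_ord -mulr_natr -natr1 /r; lra.
apply: ler_sum => i _; rewrite /clique_cut.
have -> : #|~: S i|%SET%:R = #|V|%:R - #|S i|%:R :> R.
  by rewrite -(cardsC (S i)) natrD; ring.
move: (S1 i) (Sle i); rewrite -(ler_nat R) -[in X in _ -> X](ler_nat R) natrD /r.
by nra.
Qed.

Lemma cost_ge0 k (f : {set V} -> R) (S : {ffun 'I_k -> {set V}}) :
  nonnegative f -> 0 <= cost f S.
Proof. by move=> f0; apply: sumr_ge0 => i _. Qed.

Lemma opt_le_cost k (f : {set V} -> R) (S : {ffun 'I_k -> {set V}}) :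
  nonnegative f -> kpartition S -> opt k f <= cost f S.
Proof.
move=> f0 pS; apply: ge_inf; last by exists S.
by exists 0 => _ [T _ <-]; apply: cost_ge0.
Qed.

Lemma opt_ge0 k (f : {set V} -> R) : nonnegative f -> 0 <= opt k f.
Proof.
move=> f0; have [[S pS]|nS] := pselect (exists S : {ffun 'I_k -> {set V}}, kpartition S).
  apply: lb_le_inf; first by exists (cost f S), S.
  by move=> _ [T _ <-]; apply: cost_ge0.
(* Without any k-partition [opt] is the infimum of the empty set, which is 0. *)
rewrite /opt (_ : [set _ | _ in _]%classic = classical_sets.set0) ?inf0//.
by rewrite -classical_sets.subset0 => t [T pT _]; case: nS; exists T.
Qed.

Definition singletons_and_rest H : {ffun 'I_#|H|.+1 -> {set V}} :=
  [ffun i => if unlift ord0 i is Some j then [set enum_val j]%SET else (~: H)%SET].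

Lemma kpartition_singletons_and_rest H : (~: H)%SET != set0 ->
  kpartition (singletons_and_rest H).
Proof.
move=> HC0; split=> [i|i j|].
- rewrite ffunE; case: unliftP => [j _|_] //.
  by apply/set0Pn; exists (enum_val j); rewrite inE.
- rewrite !ffunE; case: (unliftP ord0 i) => [i'|] ->; case: (unliftP ord0 j) => [j'|] -> //.
  + rewrite disjoints1 inE.
    by apply: contra => /eqP/enum_val_inj ->.
  + by rewrite disjoints1 inE negbK enum_valP.
  + by rewrite disjoint_sym disjoints1 inE negbK enum_valP.
apply/setP => v; rewrite inE; apply/bigcupP.
have [vH|vH] := boolP (v \in H).
  exists (lift ord0 (enum_rank_in vH v)) => //.
  by rewrite ffunE liftK inE enum_rankK_in.
by exists ord0 => //; rewrite ffunE unlift_none inE.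
Qed.

(** The large part has imbalance -1 and keeps only the share 1 - (1 - delta)^2 <= 2 delta of its
    clique cut; each singleton costs at most n - 1. *)
Lemma opt_planted_cut_le (delta : R) H M : 0 <= delta -> delta <= 1 ->
  #|H| = M -> H != set0 -> (~: H)%SET != set0 ->
  opt M.+1 (planted_cut delta H) <= M%:R * #|V|%:R * (1 + 2 * delta).
Proof.
move=> d0 d1 <- H0 HC0.
have [F0 _ _] := planted_cut_instance d0 H0 HC0.
apply: le_trans (opt_le_cost F0 (kpartition_singletons_and_rest HC0)) _.
have cHC : #|~: H|%SET%:R = #|V|%:R - #|H|%:R :> R.
  by rewrite -(cardsC H) natrD; ring.
have rest : planted_cut delta H (~: H)%SET <= 2 * delta * (#|H|%:R * (#|V|%:R - #|H|%:R)).
  rewrite /planted_cut imbalanceC// sqdistN// /clique_cut setCK.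
  have -> : imbalance R H H = 1.
    rewrite /imbalance setIid setDv cards0 mul0r subr0 divff//.
    by rewrite pnatr_eq0 cards_eq0.
  rewrite sqdist1// cHC.
  have : 0 <= #|H|%:R * (#|V|%:R - #|H|%:R) * delta ^+ 2.
    by rewrite -cHC !mulr_ge0 ?sqr_ge0.
  by lra.
have single (j : 'I_#|H|) : planted_cut delta H [set enum_val j]%SET <= #|V|%:R - 1.
  apply: le_trans (planted_cut_le _ _ _) _; rewrite /clique_cut cards1 mul1r.
  by rewrite -(cardsC [set enum_val j]%SET) cards1 natrD; lra.
rewrite /cost big_ord_recl ffunE unlift_none.
under eq_bigr do rewrite ffunE liftK.
apply: le_trans (lerD rest (ler_sum _ (fun j _ => single j))) _.
rewrite sumr_const card_ord -mulr_natr.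
have : 0 <= delta * #|H|%:R ^+ 2 by rewrite mulr_ge0 ?sqr_ge0.
have : 0 <= #|H|%:R :> R by [].
by lra.
Qed.

End Costs.

(** * A Hoeffding bound for uniform choice functions, in counting form *)

(** Here exp u <= 1 / (1 - u), and (1 - u) (1 + u + 2 u^2) = 1 + u^2 (1 - 2 u). *)
Lemma expR_le_quadratic (R : realType) (u : R) :
  u <= 1 / 2 -> expR u <= 1 + u + 2 * u ^+ 2.
Proof.
move=> u2; have u1 : 0 < 1 - u by lra.
apply: (@le_trans _ _ (1 - u)^-1).
  rewrite -[u in expR u]opprK expRN lef_pV2 ?posrE ?expR_gt0//.
  exact: expR_ge1Dx.
rewrite -[leLHS]mul1r ler_pdivrMr//.
have : 0 <= u ^+ 2 * (1 - 2 * u) by rewrite mulr_ge0 ?sqr_ge0//; lra.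
by lra.
Qed.

Section Hoeffding.
Variables (R : realType) (I J : finType) (X : I -> J -> R).
Hypothesis X_centered : forall i, \sum_j X i j = 0.
Hypothesis X_bounded : forall i j, `|X i j| <= 1.

(** The sum over choice functions factors over [I]; centering kills the linear term of each factor,
    leaving at most |J| (1 + 2 lambda^2). *)
Lemma sum_expR_le (lambda : R) : 0 <= lambda <= 1 / 2 ->
  \sum_(c : {ffun I -> J}) expR (lambda * \sum_i X i (c i)) <=
    #|J|%:R ^+ #|I| * expR (2 * lambda ^+ 2 * #|I|%:R).
Proof.
move=> /andP[l0 l2].
under eq_bigr do rewrite mulr_sumr expR_sum.
rewrite -(bigA_distr_bigA (fun i j => expR (lambda * X i j))).
rewrite expRM_natr -exprMn -prodr_const.
apply: ler_prod => i _; apply/andP; split.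
  by apply: sumr_ge0 => j _; apply: expR_ge0.
apply: (@le_trans _ _ (\sum_j (lambda * X i j + (1 + 2 * lambda ^+ 2)))).
  apply: ler_sum => j _; have := X_bounded i j; rewrite ler_norml => /andP[x1 x2].
  apply: le_trans (expR_le_quadratic _) _; first by nra.
  have : 0 <= lambda ^+ 2 * (1 - X i j ^+ 2).
    by rewrite mulr_ge0 ?sqr_ge0//; nra.
  by lra.
rewrite big_split /= -mulr_sumr X_centered mulr0 add0r sumr_const.
rewrite -(mulr_natl (1 + 2 * lambda ^+ 2)).
by rewrite ler_wpM2l// expR_ge1Dx.
Qed.

Lemma card_sum_gt (eta : R) : 0 <= eta <= 2 ->
  #|[set c : {ffun I -> J} | eta * #|I|%:R < \sum_i X i (c i)]|%SET%:R <=
    #|J|%:R ^+ #|I| * expR (- (eta ^+ 2 / 8 * #|I|%:R)).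
Proof.
move=> /andP[e0 e2].
(* The choice lambda = eta / 4 minimises 2 lambda^2 - lambda eta, with value - eta^2 / 8. *)
have l2 : 0 <= eta / 4 <= 1 / 2 by apply/andP; split; lra.
have := sum_expR_le l2.
set B := finset _; set M : R := #|I|%:R.
have : \sum_(c in B) expR (eta / 4 * (eta * M))
    <= \sum_(c : {ffun I -> J}) expR (eta / 4 * \sum_i X i (c i)).
  rewrite big_mkcond /=; apply: ler_sum => c _; case: ifP => [|_]; last exact: expR_ge0.
  by rewrite inE ler_expR => cB; rewrite ler_wpM2l ?(ltW cB)//; lra.
rewrite sumr_const -(mulr_natl (expR _)) => h1 h2; have := le_trans h1 h2.
rewrite -ler_pdivlMr ?expR_gt0// -expRN => h; apply: le_trans h _.
rewrite -[leLHS]mulrA -expRD le_eqVlt; apply/orP; left; apply/eqP.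
by congr (_ * expR _); field.
Qed.
End Hoeffding.

Lemma card_norm_sum_gt (R : realType) (I J : finType) (X : I -> J -> R) (eta : R) :
    (forall i, \sum_j X i j = 0) -> (forall i j, `|X i j| <= 1) -> 0 <= eta <= 2 ->
  #|[set c : {ffun I -> J} | eta * #|I|%:R < `|\sum_i X i (c i)|]|%SET%:R <=
    2 * (#|J|%:R ^+ #|I| * expR (- (eta ^+ 2 / 8 * #|I|%:R))).
Proof.
move=> X0 X1 e2.
have pos := card_sum_gt X0 X1 e2.
have NX0 i : \sum_j - X i j = 0 by rewrite sumrN X0 oppr0.
have NX1 i j : `|- X i j| <= 1 by rewrite normrN.
have neg := card_sum_gt NX0 NX1 e2.
rewrite mulr_natl mulr2n; apply: le_trans (lerD pos neg).
rewrite -natrD ler_nat; apply: leq_trans (leq_card_setU _ _).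
apply/subset_leq_card/fintype.subsetP => c.
by rewrite !inE ltr_normr sumrN.
Qed.

(** * The hidden set, with one element from each block *)

Lemma card_setI_imset (T V : finType) (e : T -> V) (Q : {set V}) : injective e ->
  #|Q :&: e @: [set: T]|%SET = (\sum_t (e t \in Q))%N.
Proof.
move=> inj_e; have -> : (Q :&: e @: [set: T] = e @: (e @^-1: Q))%SET.
  apply/setP => v; rewrite inE; apply/andP/imsetP => [[vQ /imsetP[t _ vt]]|[t tQ ->]].
    by exists t; rewrite // inE -vt.
  by split; [rewrite inE in tQ|rewrite imset_f].
rewrite card_imset// -sum1_card big_mkcond /=.
by apply: eq_bigr => t _; rewrite inE; case: ifP.
Qed.

Section HiddenSet.
Variables (R : realType) (V : finType) (M L : nat) (e : 'I_M * 'I_L -> V).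
Hypothesis inj_e : injective e.
Implicit Types (c : {ffun 'I_M -> 'I_L}) (Q : {set V}).

Definition hidden_set c : {set V} := ((fun j => e (j, c j)) @: [set: 'I_M])%SET.

Lemma hidden_set_inj c : injective (fun j => e (j, c j)).
Proof. by move=> i j /inj_e[]. Qed.

Lemma card_hidden_set c : #|hidden_set c| = M.
Proof. by rewrite card_imset ?cardsT ?card_ord//; apply: hidden_set_inj. Qed.

Definition centered_hit Q (j : 'I_M) (i : 'I_L) : R :=
  (e (j, i) \in Q)%:R - (\sum_i' (e (j, i') \in Q)%:R) / L%:R.

Lemma centered_hit_sum Q j : (0 < L)%N -> \sum_i centered_hit Q j i = 0.
Proof.
move=> L0; rewrite big_split /= sumr_const card_ord mulNrn -(mulr_natr (_ / _)).
by rewrite divfK ?subrr// pnatr_eq0 -lt0n.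
Qed.

Lemma centered_hit_bounded Q j i : (0 < L)%N -> `|centered_hit Q j i| <= 1.
Proof.
move=> L0; rewrite /centered_hit; set s := \sum_(_ < _) _.
have s0 : 0 <= s by apply: sumr_ge0.
have s1 : s <= L%:R.
  rewrite -[L in leRHS]card_ord -sum1_card natr_sum; apply: ler_sum => i' _.
  by case: (_ \in _).
have : 0 <= s / L%:R <= 1.
  by rewrite divr_ge0// ler_pdivrMr ?mul1r// ltr0n.
by case: (_ \in _) => /= /andP[q0 q1]; rewrite ler_norml; apply/andP; split; lra.
Qed.

(** [sqdist] vanishes once the imbalance of [Q] is within [delta]. The imbalance comes from hits
    deviating from their mean and from elements of [V] outside all blocks. *)
Lemma planted_cut_hidden_set (delta : R) c Q :
    (0 < M)%N -> (0 < L)%N -> (2 * M <= #|V|)%N -> 0 <= delta ->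
    #|V|%:R - (M * L)%:R <= delta * #|V|%:R / 4 ->
    `|\sum_j centered_hit Q j (c j)| <= delta / 4 * M%:R ->
  planted_cut delta (hidden_set c) Q = clique_cut R Q.
Proof.
move=> M0 L0 MV d0 nML hits.
rewrite /planted_cut sqdist_eq0 ?mulr0 ?subr0//.
set E := (e @: [set: 'I_M * 'I_L])%SET.
have cE : #|E| = (M * L)%N by rewrite card_imset// cardsT card_prod !card_ord.
have MLV : (M * L <= #|V|)%N by rewrite -cE max_card.
have sE : \sum_j \sum_i (e (j, i) \in Q)%:R = #|Q :&: E|%SET%:R :> R.
  by rewrite card_setI_imset// natr_sum pair_big; apply: eq_bigr => -[].
have bE : \sum_j (e (j, c j) \in Q)%:R = #|Q :&: hidden_set c|%SET%:R :> R.
  by rewrite card_setI_imset ?natr_sum//; apply: hidden_set_inj.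
move: hits; rewrite /centered_hit big_split /= sumrN -mulr_suml sE bE.
have cC : #|~: hidden_set c|%SET%:R = #|V|%:R - M%:R :> R.
  by rewrite -(cardsC (hidden_set c)) card_hidden_set natrD; ring.
have cQE : (#|Q :&: E| <= #|Q|)%N by rewrite subset_leq_card ?subsetIl.
have cQE' : (#|Q| <= #|Q :&: E| + #|~: E|)%N.
  by rewrite -[leqLHS](cardsID E) leq_add2l setDE subset_leq_card ?subsetIr.
have cEE : (#|Q :&: E| <= M * L)%N by rewrite -cE subset_leq_card ?subsetIr.
have cCE : #|~: E|%SET%:R = #|V|%:R - M%:R * L%:R :> R.
  by rewrite -(cardsC E) cE natrD natrM; ring.
rewrite /imbalance cC card_hidden_set.
have -> : #|Q :\: hidden_set c|%SET%:R = #|Q|%:R - #|Q :&: hidden_set c|%SET%:R :> R.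
  by rewrite -(cardsID (hidden_set c) Q) natrD; ring.
have QE0 : 0 <= #|Q :&: E|%SET%:R :> R by [].
move: M0 L0 MV nML QE0 cQE cQE' cEE.
rewrite -2!(ltr_nat R) -4!(ler_nat R) !natrD !natrM cCE.
move: (M%:R) (L%:R) (#|V|%:R) (#|Q|%:R) (#|Q :&: E|%SET%:R) (#|Q :&: hidden_set c|%SET%:R).
move=> m l n s t b m0 l0 mn nml t0 ts st tml.
(* [n b - m s = n (b - u) - m (s - t) + (n - m l) u], and each of the two
   errors is at most [delta n m / 4 <= delta (n - m) m / 2] *)
have [u ut] : {u | t = u * l} by exists (t / l); rewrite divfK// gt_eqF.
rewrite ut mulfK ?gt_eqF// !ler_norml => /andP[h1 h2].
have rm0 : 0 < (n - m) * m by rewrite mulr_gt0//; lra.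
have -> : b / m - (s - b) / (n - m) = (n * b - m * s) / ((n - m) * m).
  field; rewrite !gt_eqF//; lra.
rewrite ler_pdivlMr// ler_pdivrMr// ut in t0 ts st tml *.
have u0 : 0 <= u by rewrite -(pmulr_lge0 _ l0).
have um : u <= m by rewrite -(ler_pM2r l0).
have d_ge0 : 0 <= n - m * l by lra.
have dm := ler_wpM2r (ltW m0) nml.
have du0 : 0 <= (n - m * l) * u by rewrite mulr_ge0.
have dum : (n - m * l) * u <= (n - m * l) * m by rewrite ler_wpM2l.
have n0 : 0 <= n by lra.
have hn1 := ler_wpM2l n0 h1; have hn2 := ler_wpM2l n0 h2.
have rest : 0 <= delta * m * (n - 2 * m) by rewrite !mulr_ge0 ?(ltW m0)//; lra.
have mst : 0 <= m * (s - u * l) by rewrite mulr_ge0 ?(ltW m0)//; lra.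
have mst' : m * (s - u * l) <= m * (n - m * l).
  by rewrite ler_wpM2l ?(ltW m0)//; lra.
by apply/andP; split; lra.
Qed.
End HiddenSet.

(** * Runs of query trees, the union bound and measurability *)

Section QueryTrees.
Variables (R : realType) (V : finType) (O : Type).
Implicit Types (f g : {set V} -> R) (t : query_tree R V O).

Fixpoint queries f t : seq {set V} :=
  match t with
  | Answer _ => [::]
  | Query Q next => Q :: queries f (next (f Q))
  end.

Lemma size_queries f t : size (queries f t) = nqueries f t.
Proof. by elim: t => //= Q next IH; rewrite IH. Qed.

(** Equal answers lead to equal next queries, so the run on [g] stays in the branch taken on [f]. *)
Lemma eq_in_output f g t :
  {in queries f t, g =1 f} -> output g t = output f t.
Proof.
elim: t => //= Q next IH gf; rewrite gf ?mem_head//; apply: IH => S SQ.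
by rewrite gf// inE SQ orbT.
Qed.

End QueryTrees.

Lemma card_has_le (T : eqType) (C : finType) (R : realType)
    (P : C -> pred T) (B : R) (s : seq T) :
    (forall x, #|[set c | P c x]|%SET%:R <= B) ->
  #|[set c | has (P c) s]|%SET%:R <= (size s)%:R * B.
Proof.
move=> PB; elim: s => [|x s IH] /=.
  by rewrite (_ : finset _ = set0) ?cards0 ?mul0r//; apply/setP => c; rewrite !inE.
have -> : [set c | P c x || has (P c) s] = ([set c | P c x] :|: [set c | has (P c) s])%SET.
  by apply/setP => c; rewrite !inE.
rewrite mulrSr mulrDl mul1r addrC; apply: le_trans (lerD (PB x) IH).
by rewrite -natrD ler_nat leq_card_setU.
Qed.

Lemma measurable_fun_nat_comp (d : measure_display) (Omega : measurableType d)
    (d' : measure_display) (U : measurableType d') (u : Omega -> nat) (h : nat -> U) :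
    (forall q, measurable [set w | u w = q]%classic) ->
  measurable_fun [set: Omega]%classic (h \o u).
Proof.
move=> mu _ Y mY; rewrite classical_sets.setTI.
rewrite (_ : _ @^-1` _ = \bigcup_(q in [set q | Y (h q)]) [set w | u w = q])%classic.
  by apply: bigcup_measurable.
apply/seteqP; split=> [w Yw|w [q Yq uw]]; first by exists (u w).
by rewrite /preimage /= uw.
Qed.

(** * From indistinguishability to many expected queries *)

Section Indistinguishability.
Variables (R : realType) (V : finType) (k : nat) (C : finType).
Variables (f : {set V} -> R) (g : C -> {set V} -> R) (alpha B : R).
Hypothesis separated : forall c (S : {ffun 'I_k -> {set V}}),
  approx_solution alpha (g c) S -> cost (g c) S < cost f S.
Hypothesis rarely_differ : forall Q, #|[set c | g c Q != f Q]|%SET%:R <= B.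

(** If [g c] agrees with [f] on the queries of the run on [f] and on the [k] parts of its output,
    the run on [g c] returns the same partition at the same cost, against [separated]. The union
    bound counts the other [c]. *)
Lemma card_approx_output (t : query_tree R V {ffun 'I_k -> {set V}}) :
  #|[set c | `[< approx_solution alpha (g c) (output (g c) t) >]]|%SET%:R
    <= (nqueries f t + k)%:R * B.
Proof.
pose S := output f t.
have := card_has_le (queries f t ++ [seq S i | i : 'I_k]) rarely_differ.
rewrite size_cat size_queries size_map -cardE card_ord; apply: le_trans.
rewrite ler_nat; apply/subset_leq_card/fintype.subsetP => c; rewrite !inE => /asboolP.
apply: contraPT; rewrite has_cat negb_or => /andP[/hasPn tQ /hasPn tS].
have -> : output (g c) t = S.
  by apply: eq_in_output => Q /tQ /negPn/eqP.
move=> /separated; rewrite /cost (eq_bigr (fun i => f (S i))) ?ltxx// => i _.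
by apply/eqP/negPn/tS/map_f; rewrite mem_enum.
Qed.

(** The success probabilities sum to the expected number of [c] solved, which [card_approx_output]
    bounds at each sample point, where the algorithm is deterministic. *)
Lemma expected_queries_ge (d : measure_display) (Omega : measurableType d)
    (P : probability Omega R) (A : Omega -> partition_algorithm R) (p : R) :
    (0 < k <= #|V|)%N -> sym_sub_instance f -> (forall c, sym_sub_instance (g c)) ->
    measurable_algorithm A -> achieves_approximation P alpha p A ->
  ((p * #|C|%:R)%:E <= (expected_queries P A k f + k%:R%:E) * B%:E)%E.
Proof.
move=> kV fI gI mA apA.
pose E c := [set w | approx_solution alpha (g c) (output (g c) (A w V k))]%classic.
have mE c : measurable (E c).
  rewrite (_ : E c = \bigcup_(S in [set S | approx_solution alpha (g c) S])
      [set w | output (g c) (A w V k) = S])%classic.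
    apply: fin_bigcup_measurable; first exact: finite_finset.
    by move=> S _; apply: (mA V k (g c) kV (gI c)).1.
  apply/seteqP; split=> [w Ew|w [S aS wS]]; last by rewrite /E /= wS.
  by exists (output (g c) (A w V k)).
have mq := (mA V k f kV fI).2.
have B0 : 0 <= B by apply: le_trans (rarely_differ set0).
have mnq (h : nat -> \bar R) :
    measurable_fun [set: Omega]%classic (fun w => h (nqueries f (A w V k))).
  exact: (measurable_fun_nat_comp h mq).
have -> : ((p * #|C|%:R)%:E = \sum_(c : C) p%:E)%E.
  by rewrite sumEFin sumr_const mulr_natr.
apply: (@le_trans _ _ (\sum_(c : C) P (E c))%E).
  by apply: lee_sum => c _; apply: apA.
have -> : (\sum_(c : C) P (E c) = \int[P]_w (\sum_(c : C) (\1_(E c) w)%:E))%E.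
  rewrite ge0_integral_sum//.
  - by apply: eq_bigr => c _; rewrite integral_indic// classical_sets.setIT.
  - by move=> c; apply/measurable_EFinP; apply: measurable_indic.
apply: (@le_trans _ _ (\int[P]_w (((nqueries f (A w V k))%:R%:E + k%:R%:E) * B%:E))%E).
  apply: ge0_le_integral => //.
  - by move=> w _; apply: sume_ge0 => c _; rewrite lee_fin.
  - apply: emeasurable_sum => c.
    by apply/measurable_EFinP; apply: measurable_indic.
  - exact: (mnq (fun q => (q%:R%:E + k%:R%:E) * B%:E)%E).
  move=> w _; rewrite sumEFin -EFinD -EFinM lee_fin -natrD.
  apply: le_trans (card_approx_output (A w V k)).
  rewrite -sum1_card natr_sum [leRHS]big_mkcond /=; apply: ler_sum => c _.
  rewrite inE indicE; case: asboolP => Ew; first by rewrite mem_set.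
  by rewrite memNset.
rewrite ge0_integralZr//.
- rewrite ge0_integralD//; last exact: (mnq (fun q => q%:R%:E)).
  rewrite integral_cst//; set PT := (X in (_ + _ * X)%E).
  by have -> : PT = 1%E; [exact: probability_setT|rewrite mule1].
- exact: (mnq (fun q => q%:R%:E + k%:R%:E)%E).
- by move=> w _; rewrite adde_ge0// lee_fin.
Qed.

End Indistinguishability.

(** * Choice of parameters and the exponential bound *)

Lemma exists_injection (T V : finType) :
  (#|T| <= #|V|)%N -> exists e : T -> V, injective e.
Proof.
move=> TV; exists (fun x => enum_val (widen_ord TV (enum_rank x))) => x y.
by move/enum_val_inj/(congr1 val) => /= xy; apply/enum_rank_inj/val_inj.
Qed.

Lemma exists_nat_gt (R : realType) (x : R) : exists n : nat, x < n%:R.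
Proof.
exists (Num.bound `|x|); apply: le_lt_trans (ler_norm x) _.
exact: archi_boundP.
Qed.

(** Since (2 - 8 delta) (1 + 2 delta) <= 2 - 4 delta, the solution costs at most M n (2 - 4 delta),
    below the clique bound M (2 n - M - 1). *)
Lemma planted_cost_lt (R : realType) (V : finType) (H : {set V}) (eps delta : R) (M : nat)
    (S : {ffun 'I_M.+1 -> {set V}}) :
    0 <= delta -> delta <= 1 -> 8 * delta <= eps -> 8 * delta <= 1 ->
    #|H| = M -> H != set0 -> (~: H)%SET != set0 ->
    M%:R + 1 < 4 * delta * #|V|%:R ->
  approx_solution (2 - eps) (planted_cut delta H) S ->
  cost (planted_cut delta H) S < cost (@clique_cut R V) S.
Proof.
move=> d0 d1 de d8 HM H0 HC0 Mn [pS cS].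
apply: le_lt_trans cS (lt_le_trans _ (clique_cut_cost_ge R pS)).
have [F0 _ _] := planted_cut_instance d0 H0 HC0.
have o0 := opt_ge0 M.+1 F0.
have oM := opt_planted_cut_le d0 d1 HM H0 HC0.
have M0 : 0 < M%:R :> R by rewrite ltr0n -HM card_gt0.
apply: (@le_lt_trans _ _ ((2 - 8 * delta) * opt M.+1 (planted_cut delta H))).
  by rewrite ler_wpM2r//; lra.
have d2 : 0 <= 2 - 8 * delta by lra.
apply: le_lt_trans (ler_wpM2l d2 oM) _.
rewrite mulrCA -!mulrA ltr_pM2l//.
have n0 : 0 <= #|V|%:R * delta ^+ 2 :> R by rewrite mulr_ge0 ?sqr_ge0.
by move: n0 Mn; lra.
Qed.

Lemma card_planted_cut_neq (R : realType) (V : finType) (M L : nat)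
    (e : 'I_M * 'I_L -> V) (delta : R) (Q : {set V}) :
    injective e -> (0 < M)%N -> (0 < L)%N -> (2 * M <= #|V|)%N -> 0 <= delta -> delta <= 1 ->
    #|V|%:R - (M * L)%:R <= delta * #|V|%:R / 4 ->
  #|[set c | planted_cut delta (hidden_set e c) Q != clique_cut R Q]|%SET%:R
    <= 2 * (L%:R ^+ M * expR (- ((delta / 4) ^+ 2 / 8 * M%:R))).
Proof.
move=> inj_e M0 L0 MV d0 d1 nML.
have eta2 : 0 <= delta / 4 <= 2 by apply/andP; split; lra.
have := card_norm_sum_gt (fun j => centered_hit_sum R e Q j L0)
  (fun j i => centered_hit_bounded R e Q j i L0) eta2.
rewrite !card_ord; apply: le_trans; rewrite ler_nat.
apply/subset_leq_card/fintype.subsetP => c; rewrite !inE ltNge.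
by apply: contra => /planted_cut_hidden_set -> //.
Qed.

(* Here [Y = expR (c * n)], so that [p * Y ^+ 2 / 2 - n] exceeds [Y]. *)
Lemma square_absorbs_linear (R : realType) (p c n r Y : R) : 0 < p -> 0 < c ->
  1 + c * n <= Y -> 2 * (1 + c^-1) / (p * c) < n -> p * Y ^+ 2 <= 2 * (r + n) -> Y <= r.
Proof.
move=> p0 c0 cY; rewrite ltr_pdivrMr ?mulr_gt0// => nb pY.
have n0 : 0 < n * (p * c).
  by apply: lt_trans nb; rewrite mulr_gt0// addr_gt0// invr_gt0.
have Y0 : 0 < Y by move: n0; rewrite pmulr_lgt0 ?mulr_gt0// => /(mulr_gt0 c0); lra.
have nY : n <= Y / c by rewrite ler_pdivlMr// mulrC; lra.
have : 2 * (1 + c^-1) <= p * Y by apply: (le_trans (ltW nb)); nra.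
by move/(ler_wpM2l (ltW Y0)); nra.
Qed.

Theorem theorem1 (R : realType) (eps p : R) (heps : 0 < eps) (hp : 0 < p) :
  exists (c : R) (n0 : nat), 0 < c /\
    forall (d : measure_display) (Omega : measurableType d)
      (P : probability Omega R) (A : Omega -> partition_algorithm R),
      measurable_algorithm A ->
      achieves_approximation P (2 - eps) p A ->
      forall V : finType, (n0 <= #|V|)%N ->
        exists (k : nat) (f : {set V} -> R),
          [/\ (0 < k <= #|V|)%N, sym_sub_instance f
            & ((expR (c * #|V|%:R))%:E <= expected_queries P A k f)%E].
Proof.
(* The cap at 1 keeps [2 - 8 * delta] positive even when [eps] is at least 2. *)
pose delta : R := Num.min eps 1 / 8.
have m0 : 0 < Num.min eps 1 by rewrite lt_min heps ltr01.
have d0 : 0 < delta by rewrite divr_gt0.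
have d8 : 8 * delta <= 1 by rewrite mulrC divfK ?ge_min ?lexx ?orbT.
have de : 8 * delta <= eps by rewrite mulrC divfK ?ge_min ?lexx.
have d1 : delta <= 1 by lra.
(* Block length: above 1 / delta it makes the hidden set smaller than delta n, and above 2 at most
   half of [V]. *)
have [L0 L0d] := exists_nat_gt (2 + delta^-1).
have Ld : 1 < delta * L0%:R by rewrite mulrC -ltr_pdivrMr// mul1r; lra.
have L2 : 2 < L0%:R :> R by have := invr_gt0 delta; rewrite d0; lra.
have L_gt0 : (0 < L0)%N by rewrite -(ltr_nat R); lra.
move: L0 Ld L2 L_gt0 {L0d} => L Ld L2 L_gt0.
have L0 : 0 < L%:R :> R by rewrite ltr0n.
pose gamma : R := (delta / 4) ^+ 2 / 8.
have g0 : 0 < gamma by rewrite divr_gt0// exprn_gt0// divr_gt0.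
(* There will be at least n / (2 L) blocks, so exp (gamma M) is at least the square of exp (c n);
   the spare factor absorbs linear terms. *)
pose c : R := gamma / (4 * L%:R).
have c0 : 0 < c by rewrite divr_gt0// mulr_gt0.
(* The summands bound the fewer than [L] elements outside the blocks by delta n / 4, give 1 < delta
   n, and serve [square_absorbs_linear]. *)
have [n0 n0P] := exists_nat_gt (4 * L%:R / delta + delta^-1 + 2 * (1 + c^-1) / (p * c)).
exists c, n0; split=> // d Omega P A mA apA V nV.
have {n0P nV} nP : 4 * L%:R / delta + delta^-1 + 2 * (1 + c^-1) / (p * c) < #|V|%:R.
  by apply: lt_le_trans n0P _; rewrite ler_nat.
have [a0 b0 q0] : [/\ 0 <= 4 * L%:R / delta, 0 <= delta^-1 & 0 <= 2 * (1 + c^-1) / (p * c)].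
  by rewrite !divr_ge0 ?invr_ge0 ?mulr_ge0 ?addr_ge0 ?invr_ge0// ltW// mulr_gt0.
have nL : 4 * L%:R < delta * #|V|%:R by rewrite [ltRHS]mulrC -ltr_pdivrMr//; lra.
have n1 : 1 < delta * #|V|%:R by rewrite mulrC -ltr_pdivrMr// mul1r; lra.
have nc : 2 * (1 + c^-1) / (p * c) < #|V|%:R by lra.
have Vge0 : 0 <= #|V|%:R :> R by [].
have dV : delta * #|V|%:R <= #|V|%:R by rewrite ler_piMl.
have LV : L%:R < #|V|%:R :> R by lra.
pose M := (#|V| %/ L)%N.
have M0 : (0 < M)%N by rewrite divn_gt0// -(ler_nat R) ltW.
have MLV : (M * L <= #|V|)%N by rewrite leq_trunc_div.
have VML : (#|V| < M * L + L)%N by rewrite -mulSnr ltn_ceil.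
have MV2 : (2 * M <= #|V|)%N.
  by apply: leq_trans MLV; rewrite mulnC leq_mul2l -(ler_nat R) ltW ?orbT.
have MV : (M < #|V|)%N by apply: leq_trans MV2; rewrite mul2n -addnn -addn1 leq_add2l.
have MLVr : M%:R * L%:R <= #|V|%:R :> R by rewrite -natrM ler_nat.
have VMLr : #|V|%:R < M%:R * L%:R + L%:R :> R by rewrite -natrM -natrD ltr_nat.
have M0r : 0 < M%:R :> R by rewrite ltr0n.
have [e inj_e] : exists e : 'I_M * 'I_L -> V, injective e.
  by apply: exists_injection; rewrite card_prod !card_ord.
have H0 b : hidden_set e b != set0 by rewrite -card_gt0 card_hidden_set.
have HC0 b : (~: hidden_set e b)%SET != set0.
  by rewrite -card_gt0 -(ltn_add2l #|hidden_set e b|) addn0 cardsC card_hidden_set.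
have nML : #|V|%:R - (M * L)%:R <= delta * #|V|%:R / 4 by rewrite natrM; lra.
have Mn : M%:R + 1 < 4 * delta * #|V|%:R.
  have := ler_wpM2l (ltW M0r) (ltW Ld); have := ler_wpM2l (ltW d0) MLVr.
  by lra.
have fI := clique_cut_instance R V.
have gI (b : {ffun 'I_M -> 'I_L}) : sym_sub_instance (planted_cut delta (hidden_set e b)).
  exact: planted_cut_instance (ltW d0) (H0 b) (HC0 b).
exists M.+1, (@clique_cut R V); split=> //.
have := expected_queries_ge
  (fun b S => @planted_cost_lt R V (hidden_set e b) eps delta M S (ltW d0) d1 de d8
    (card_hidden_set inj_e b) (H0 b) (HC0 b) Mn)
  (fun Q => card_planted_cut_neq Q inj_e M0 L_gt0 MV2 (ltW d0) d1 nML)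
  MV fI gI mA apA.
have : (0 <= expected_queries P A M.+1 (@clique_cut R V))%E by exact: integral_ge0.
case: expected_queries => [r r0|_ _|//]; last exact: leey.
rewrite -EFinD -EFinM !lee_fin card_ffun !card_ord natrX => bound.
have LM0 : 0 < L%:R ^+ M :> R by rewrite exprn_gt0.
apply: (@square_absorbs_linear R p c #|V|%:R r) => //; first exact: expR_ge1Dx.
rewrite -expRM_natr.
have gM : c * #|V|%:R * 2 <= gamma * M%:R.
  have -> : c * #|V|%:R * 2 = gamma * (#|V|%:R / (2 * L%:R)).
    by rewrite /c; field; rewrite gt_eqF.
  have LML : L%:R <= M%:R * L%:R :> R by rewrite ler_peMl ?ler1n// ltW.
  by rewrite ler_pM2l// ler_pdivrMr ?mulr_gt0//; lra.
(* The number L^M of choice functions occurs on both sides and cancels. *)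
have {bound} bound : p * expR (gamma * M%:R) <= 2 * (r + M.+1%:R).
  rewrite -ler_pdivlMr ?expR_gt0// -expRN -(ler_pM2l LM0).
  by rewrite [leLHS]mulrC (le_trans bound)// /gamma; lra.
apply: le_trans (ler_wpM2l (ltW hp) _) (le_trans bound _); first by rewrite ler_expR.
by rewrite ler_pM2l// lerD2l ler_nat.
Qed.
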